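(* Let $r$ be a positive integer or $r=\infty$. Let $G_r(z),G^\vee_r(z):B_r[z^{-1}]\to B_r[z^{-1}]$ also denote the $\mathbb{Q}[z^{-1}]$-linear extensions of the maps $G_r(z),G_r^\vee(z):B_r\to B_r[z^{-1}]$. Then $$G_r(z)\circ G^\vee_r(z)=G^\vee_r(z)\circ G_r(z)=1_{B_r[z^{-1}]},$$ i.e. they are inverse of each other.
   Context: Let $r\in\{1,2,3,\dots\}\cup\{\infty\}$. $B_r=\mathbb{Q}[e_i : i\in\mathbb{N},\ 1\le i\le r]$ is a polynomial ring; $e_0=1$ and $e_i=0$ for $i>r$. $E_r(t)=1+\sum_{1\le i\le r}(-1)^ie_it^i\in B_r[[t]]$, and $H_r=(h_n)_{n\in\mathbb{Z}}$ is defined by $\sum_{n\in\mathbb{Z}}h_nt^n=1/E_r(t)$ (so $h_n=0$ for $n<0$, $h_0=1$). $\mathcal{P}_r$ is the set of partitions $\boldsymbol{\lambda}=(\lambda_1\ge\lambda_2\ge\cdots)$ with at most $r$ nonzero parts (all partitions if $r=\infty$). $\Delta_{\boldsymbol{\lambda}}(H_r)=\det(h_{\lambda_j-j+i})_{1\le i,j\le k}$, where $k=r$ if $r<\infty$ and $k$ is any integer at least the length of $\boldsymbol{\lambda}$ if $r=\infty$ (the value does not depend on $k$). It is known that $(\Delta_{\boldsymbol{\lambda}}(H_r))_{\boldsymbol{\lambda}\in\mathcal{P}_r}$ is a $\mathbb{Q}$-basis of $B_r$. For $j\in\mathbb{Z}$ let $u_j=\sum_{n\ge0}h_{n+j}\frac{t^n}{n!}\in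 B_r[[t]]$ (linearly independent over $\mathbb{Q}$). Semi-infinite exterior monomials $u_{i_0}\wedge u_{i_1}\wedge\cdots$ (with $i_{m+1}=i_m-1$ for all large $m$) are formal symbols over $\mathbb{Q}$, alternating in their entries. Put $\Phi^r_{i,\boldsymbol{\lambda}}=u_{i+\lambda_1}\wedge u_{i-1+\lambda_2}\wedge u_{i-2+\lambda_3}\wedge\cdots$ (with $\lambda_m=0$ beyond the length of $\boldsymbol{\lambda}$), $\Phi^r_0=\Phi^r_{0,(0)}$. Contraction with the dual vector $u_i^\vee$ ($u_i^\vee(u_j)=\delta_{ij}$) is $u_i^\vee\lrcorner(u_{i_0}\wedge u_{i_1}\wedge\cdots)=\sum_{m\ge0}(-1)^m\delta_{i,i_m}\,u_{i_0}\wedge\cdots\wedge\widehat{u_{i_m}}\wedge\cdots$ (hat means omitted). For $\phi=\sum_{n\ge0}a_n\frac{t^n}{n!}\in B_r[[t]]$ and $k\in\mathbb{N}$ let $U_k(\phi)=a_k+\sum_{i\ge1}(-1)^ie_ia_{k-i}$, where $a_j=0$ for $j<0$; then $\phi=\sum_{i\ge0}U_i(\phi)u_{-i}$. For a monomial $\alpha=u_{i_0}\wedge u_{i_1}\wedge\cdots$ with $i_m=-m$ for all $m\ge k$, put $[\alpha]=(\alpha\otimes_{\mathbb{Q}}1_{B_r})/\Phi^r_0=\det\big(U_a(u_{i_b})\big)_{0\le a,b\le k-1}\in B_r$ (independent of $k$; this is the result of expanding each $u_{i_b}$ $B_r$-linearly in the $u_{-a}$, $a\ge0$). Extend $[\cdot]$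 $\mathbb{Q}$-linearly. The vertex operators are the $\mathbb{Q}$-linear maps on $B_r$ with $\Gamma_r(z)\Delta_{\boldsymbol{\lambda}}(H_r)=\sum_{i\in\mathbb{Z}}[u_i\wedge\Phi^r_{-1,\boldsymbol{\lambda}}]\,z^i$ and $\Gamma^\vee_r(z)\Delta_{\boldsymbol{\lambda}}(H_r)=\sum_{i\in\mathbb{Z}}[u_i^\vee\lrcorner\Phi^r_{1,\boldsymbol{\lambda}}]\,z^{-i}$ for $\boldsymbol{\lambda}\in\mathcal{P}_r$; their values lie in $B_r((z))$. $G_r(z)$ and $G^\vee_r(z)$ are the $\mathbb{Q}$-linear maps with $G_r(z)\Delta_{\boldsymbol{\lambda}}(H_r)=E_r(z)\,\Gamma_r(z)\Delta_{\boldsymbol{\lambda}}(H_r)$ and $G^\vee_r(z)\Delta_{\boldsymbol{\lambda}}(H_r)=\big(z\,\Gamma^\vee_r(z)\Delta_{\boldsymbol{\lambda}}(H_r)\big)/E_r(z)$; both take values in $B_r[z^{-1}]$. *)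

(* Defs.v *)
From HB Require Import structures.
From mathcomp Require Import all_boot all_order all_algebra zify.
From mathcomp Require Import finmap monalg.
From mathcomp Require Import boolp classical_sets functions fsbigop.

Set Implicit Arguments.
Unset Strict Implicit.
Unset Printing Implicit Defensive.

Import Order.TTheory GRing.Theory Num.Theory.
Local Open Scope ring_scope.

(* Power series are coefficient functions [nat -> R]; series in z infinite in
   both directions are coefficient functions [int -> R], and a Laurent series
   is such a function vanishing at all sufficiently negative integers.
   R[z^-1] is {poly R}, its variable 'X standing for z^-1; likewise Q[z^-1] is
   {poly rat}. *)
Section Series.
Variable R : comNzRingType.
Implicit Types (a : nat -> R) (f : int -> R).

Fixpoint psinv_seq a n : seq R :=
  if n is n'.+1 then
    let s := psinv_seq a n' in
    rcons s (- \sum_(j < n'.+1) a j.+1 * s`_(n' - j))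
  else [:: 1].

(* The inverse 1/a of a power series with constant coefficient a 0 = 1. *)
Definition psinv a : nat -> R := fun n => (psinv_seq a n)`_n.

Lemma size_psinv_seq a n : size (psinv_seq a n) = n.+1.
Proof. by elim: n => //= n IHn; rewrite size_rcons IHn. Qed.

Lemma nth_psinv_seq a n i : (i <= n)%N -> (psinv_seq a n)`_i = psinv a i.
Proof.
elim: n => [|n IHn]; first by rewrite leqn0 => /eqP ->.
rewrite leq_eqVlt => /orP[/eqP -> //|lt_in].
by rewrite /= nth_rcons size_psinv_seq lt_in IHn.
Qed.

Lemma psinvP a n : a 0%N = 1 ->
  \sum_(j < n.+1) a j * psinv a (n - j)%N = (n == 0%N)%:R.
Proof.
move=> a0; case: n => [|n]; first by rewrite big_ord1 a0 mul1r.
rewrite big_ord_recl a0 mul1r subn0 {1}/psinv /= nth_rcons size_psinv_seq.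
rewrite ltnn eqxx; apply/eqP; rewrite addrC subr_eq0; apply/eqP.
by apply: eq_bigr => j _; rewrite /= subSS nth_psinv_seq ?leq_subr.
Qed.

(* The product of a power series and a Laurent series f; every coefficient sum
   is then finite by lmulE. *)
Definition lmul a f : int -> R :=
  fun n => \sum_(j \in [set: nat]%classic) a j * f (n - j%:Z).

Lemma lmulE a f n k : (forall i, i < n - k%:Z -> f i = 0) ->
  lmul a f n = \sum_(j < k.+1) a j * f (n - j%:Z).
Proof.
move=> f0; rewrite /lmul (fsbig_ord _ k.+1 (fun j => a j * f (n - j%:Z))).
apply/esym/fsbig_widen => // j [_ /negP].
rewrite /= -leqNgt => kj; rewrite f0 ?mulr0 //.
by rewrite ltrD2l ltrN2 ltz_nat.
Qed.

Definition lshift1 f : int -> R := fun n => f (n - 1).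

Definition laurent_of_poly (p : {poly R}) : int -> R :=
  fun n => if n <= 0 then p`_`|n|%N else 0.

End Series.

(* Semi-infinite exterior monomials: (s, c) stands for
   u_{i_0} /\ u_{i_1} /\ ... where i_m is the m-th entry of s for m < size s
   and i_m = c - m for m >= size s. *)
Definition wmonom : Type := (seq int * int)%type.
HB.instance Definition _ := Choice.on wmonom.

Definition widx (w : wmonom) (m : nat) : int := nth (w.2 - m%:Z) w.1 m.

Definition wcons (i : int) (w : wmonom) : wmonom := (i :: w.1, w.2 + 1).

Definition womit (m : nat) (w : wmonom) : wmonom :=
  ([seq widx w (bump m k) | k <- iota 0 (maxn m (size w.1))], w.2 - 1).

Definition phi (i : int) (la : seq nat) : wmonom :=
  (mkseq (fun m => i - m%:Z + (nth 0%N la m)%:Z) (size la), i).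

Lemma widx_phi i la m : widx (phi i la) m = i - m%:Z + (nth 0%N la m)%:Z.
Proof.
rewrite /widx /phi /=; case: (ltnP m (size la)) => H; first by rewrite nth_mkseq.
by rewrite !nth_default ?size_mkseq // addr0.
Qed.

Lemma widx_wconsS i w k : widx (wcons i w) k.+1 = widx w k.
Proof. by rewrite /widx /wcons /= intS opprD addrA addrK. Qed.

Lemma widx_womit m w k : widx (womit m w) k = widx w (bump m k).
Proof.
rewrite {1}/widx /womit /=; case: (ltnP k (maxn m (size w.1))) => H.
  by rewrite (nth_map 0%N) ?size_iota // nth_iota.
move: H; rewrite geq_max => /andP[mk wk].
rewrite nth_default ?size_map ?size_iota ?geq_max ?mk //.
by rewrite /bump mk add1n /widx nth_default ?(leqW wk) // intS opprD addrA.
Qed.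

Lemma widx_bound w i m : (size w.1 + `|w.2 - i|.+1 <= m)%N -> widx w m <> i.
Proof.
move=> H; rewrite /widx nth_default; last exact: leq_trans (leq_addr _ _) H.
by move: H; set s := size _; move: w.2 s => c s; lia.
Qed.

(* Formal Q-linear combinations of the symbols; the map bracket below is
   alternating in the entries, so it factors through the alternating quotient.
   The contraction with u_i^\vee is a sum over all m >= 0; by widx_bound the
   terms left out here vanish. *)
Definition contract (i : int) (w : wmonom) : {malg rat[wmonom]} :=
  \sum_(m < size w.1 + `|w.2 - i|.+1)
     << (-1) ^+ m * (i == widx w m)%:R *g womit m w >>.

Definition is_partition (la : seq nat) : bool := sorted geq la && (0 \notin la).

(* r : option nat, where None stands for r = infinity. *)
Section Br.
Variable r : option nat.

Definition le_r (n : nat) : bool := if r is Some k then (n <= k)%N else true.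

Definition eindex : Type := {i : nat | (0 < i)%N && le_r i}.
HB.instance Definition _ := Choice.on eindex.

Definition B : comAlgType rat := {malg rat[{cmonom eindex}]}.

Definition e (i : nat) : B :=
  if i == 0%N then 1
  else if (insub i : option eindex) is Some x then
    (<< ucm x >> : {malg rat[{cmonom eindex}]})
  else 0.

Definition E : nat -> B := fun i => (-1) ^+ i * e i.

Definition h (n : int) : B := if n is Posz m then psinv E m else 0.

Definition partitions_r (la : seq nat) : bool :=
  is_partition la && le_r (size la).

Definition Delta (la : seq nat) : B :=
  \det (\matrix_(i < odflt (size la) r, j < odflt (size la) r)
          h ((nth 0%N la j)%:Z - j%:Z + i%:Z)).

Definition u (j : int) : nat -> B :=
  fun n => (n`!%:R^-1 : rat) *: h (n%:Z + j).

Definition U (k : nat) (f : nat -> B) : B :=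
  let a n := (n`!%:R : rat) *: f n in
  a k + \sum_(1 <= i < k.+1) (-1) ^+ i * e i * a (k - i)%N.

(* Used for monomials (s, 0) only, i.e. those with i_m = -m for m >= size s. *)
Definition bracket1 (w : wmonom) : B :=
  \det (\matrix_(a < size w.1, b < size w.1) U a (u (widx w b))).

Definition bracket (x : {malg rat[wmonom]}) : B :=
  \sum_(w <- msupp x) x@_w *: bracket1 w.

(* The series Gamma_r(z) Delta_la and Gamma^\vee_r(z) Delta_la; the exponent of
   z in the second is -i for the contraction with u_i^\vee. *)
Definition Gamma_Delta (la : seq nat) : int -> B :=
  fun i => bracket << wcons i (phi (- 1) la) >>.

Definition GammaV_Delta (la : seq nat) : int -> B :=
  fun n => bracket (contract (- n) (phi 1 la)).

Definition Qlinear (G : B -> {poly B}) : Prop :=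
  forall (c : rat) (x y : B), G (c *: x + y) = (c%:A : B) *: G x + G y.

(* Since (Delta la), la ranging over partitions_r, is a Q-basis of B, the next
   two predicates each characterize one map. *)
Definition is_G (G : B -> {poly B}) : Prop :=
  Qlinear G /\
  forall la, partitions_r la ->
    laurent_of_poly (G (Delta la)) =1 lmul E (Gamma_Delta la).

Definition is_GV (G : B -> {poly B}) : Prop :=
  Qlinear G /\
  forall la, partitions_r la ->
    laurent_of_poly (G (Delta la))
      =1 lmul (psinv E) (lshift1 (GammaV_Delta la)).

(* The Q[z^-1]-linear extension of a Q-linear map. *)
Definition zext (G : B -> {poly B}) (p : {poly B}) : {poly B} :=
  \sum_(i < size p) 'X^i * G p`_i.

End Br.

(* Main.v *)
(* The coefficients of both series are Jacobi-Trudi determinants: a bracket is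
   det (h_{q_j + i}), and expanding along the column (for G) or the row (for
   G^\vee) carrying the variable z gives
     G Delta_la = Delta_la(h_n - h_{n-1} z^-1),
     G^\vee Delta_la = Delta_la(\sum_k h_{n-k} z^-k).
   Expanding these column by column, both become products over the columns of
   1 - T/z and 1/(1 - T/z), T being the shift of a column index; they extend to
   determinants with arbitrary integer indices, where they are visibly inverse.
   That the Delta_la span B_r follows from the same Laplace expansion: it writes
   e_n Delta_la as +-Delta_nu (zero when nu has more than r parts) minus terms
   +-e_{n+l} (h_l^\perp Delta_la) involving determinants of smaller weight. *)
Require Import Defs.
From mathcomp Require Import all_boot all_order all_fingroup all_algebra zify.
From mathcomp Require Import finmap monalg.

Set Implicit Arguments.
Unset Strict Implicit.
Unset Printing Implicit Defensive.

Import Order.TTheory GRing.Theory Num.Theory.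
Local Open Scope ring_scope.

(** * Determinants with arbitrary integer column indices *)

Section JacobiTrudi.
Variable R : comNzRingType.
Implicit Types (H : int -> R) (q : nat -> int).

(** The left matrix is the right one multiplied by the lower triangular Toeplitz matrix of [c],
    whose diagonal is 1. *)
Lemma det_row_conv n (c : nat -> R) (A : nat -> 'I_n -> R) : c 0%N = 1 ->
  \det (\matrix_(i < n, j < n) \sum_(l < i.+1) c l * A (i - l)%N j) =
  \det (\matrix_(i < n, j < n) A i j).
Proof.
move=> c0.
pose L := \matrix_(i < n, k < n) (if (k <= i)%N then c (i - k)%N else 0).
transitivity (\det (L *m \matrix_(i < n, j < n) A i j)).
  congr (\det _); apply/matrixP => i j; rewrite !mxE.
  under [RHS]eq_bigr do rewrite !mxE.
  rewrite (reindex_inj rev_ord_inj) /=.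
  rewrite (big_ord_widen n
    (fun l => c (i.+1 - l.+1)%N * A (i - (i.+1 - l.+1))%N j)) //.
  rewrite big_mkcond; apply: eq_bigr => k _; rewrite ltnS.
  by case: ifP => [ki|]; rewrite ?mul0r // subSS subKn.
rewrite det_mulmx det_trig; last first.
  by apply/is_trig_mxP => i k ik; rewrite mxE leqNgt ik.
by rewrite big1 ?mul1r // => i _; rewrite mxE leqnn subnn.
Qed.

(** The ring and [H] are left free so that the same manipulations serve [h] in [B] and its
    deformations in [{poly B}]. *)
Definition jt H N q : R := \det (\matrix_(i < N, j < N) H (q j + i%:Z)).

Lemma eq_jt H N q q' :
  (forall j, (j < N)%N -> q j = q' j) -> jt H N q = jt H N q'.
Proof.
by move=> qq'; congr (\det _); apply/matrixP => i j; rewrite !mxE qq'.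
Qed.

Lemma jt_neg H N q j : (forall x, x < 0 -> H x = 0) -> (j < N)%N ->
  q j + N%:Z <= 0 -> jt H N q = 0.
Proof.
move=> H0 jN qj; rewrite /jt (expand_det_col _ (Ordinal jN)) big1 // => i _.
by rewrite mxE H0 ?mul0r //=; have := ltn_ord i; lia.
Qed.

Lemma jt_rep H N q j k : (j < k < N)%N -> q j = q k -> jt H N q = 0.
Proof.
move=> /andP[jk kN] qjk; have jN := ltn_trans jk kN.
rewrite /jt -det_tr.
apply: (@determinant_alternate _ _ _ (Ordinal jN) (Ordinal kN)).
  by rewrite -val_eqE /= ltn_eqF.
by move=> i; rewrite !mxE /= qjk.
Qed.

Lemma jt_stable H N q : (forall x, x < 0 -> H x = 0) -> H 0 = 1 ->
  q N = - N%:Z -> jt H N.+1 q = jt H N q.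
Proof.
move=> Hneg H0 qN; rewrite /jt (expand_det_col _ ord_max) big_ord_recr /= big1.
  rewrite mxE /= qN addNr H0 mul1r add0r /cofactor /= -signr_odd addnn.
  rewrite odd_double mul1r; congr (\det _).
  apply/matrixP => i j; rewrite !mxE /=.
  by rewrite /bump [(N <= i)%N]leqNgt ltn_ord [(N <= j)%N]leqNgt ltn_ord.
move=> i _; rewrite mxE Hneg ?mul0r //= qN.
by have := ltn_ord i; lia.
Qed.

Lemma jt_stable_le H M N q : (forall x, x < 0 -> H x = 0) -> H 0 = 1 ->
  (forall j, (M <= j < N)%N -> q j = - j%:Z) -> (M <= N)%N ->
  jt H N q = jt H M q.
Proof.
move=> Hneg H0; elim: N => [|N IHN] qE; first by rewrite leqn0 => /eqP ->.
rewrite leq_eqVlt => /orP[/eqP -> //|]; rewrite ltnS => MN.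
rewrite jt_stable ?IHN // => [j /andP[Mj jN]|]; apply: qE;
  rewrite ?MN ?leqnn //.
by rewrite Mj ltnW.
Qed.

Lemma jt_perm H N q (s : 'S_N) q' : (forall j : 'I_N, q j = q' (s j)) ->
  jt H N q = (-1) ^+ s * jt H N q'.
Proof.
move=> qq'; rewrite /jt -det_tr -[in RHS]det_tr -det_perm -det_mulmx -row_permE.
by congr (\det _); apply/matrixP => i j; rewrite !mxE qq'.
Qed.

End JacobiTrudi.

(** * Straightening of integer index sequences to partitions *)

Definition part_idx (la : seq nat) (m : nat) : int := (nth 0%N la m)%:Z - m%:Z.

(** In a decreasing sequence zeros occur only at the end, where the default of [nth] is 0 as
    well. *)
Lemma nth_filter_nz la m : sorted geq la ->
  nth 0%N [seq x <- la | x != 0%N] m = nth 0%N la m.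
Proof.
have tr : transitive geq by move=> a b c ab bc; apply: leq_trans bc ab.
elim: la m => [|x la IHla] m //= xla.
have /= := order_path_min tr xla; have := path_sorted xla => sla /allP lex.
case: eqVneq => [x0|_] /=; last by case: m => //= m; apply: IHla.
have -> : [seq x <- la | x != 0%N] = [::].
  apply/eqP; rewrite -[_ == _]negbK -has_filter; apply/hasPn => y /lex /=.
  by rewrite x0 leqn0 => /eqP ->.
rewrite nth_nil; case: m => //= m; case: (ltnP m (size la)) => H.
  by apply/esym/eqP; rewrite -leqn0 -[X in (_ <= X)%N]x0; apply/lex/mem_nth.
by rewrite nth_default.
Qed.

Lemma sumn_filter_nz la : sumn [seq x <- la | x != 0%N] = sumn la.
Proof. by elim: la => //= x la <-; case: eqVneq => [->|]. Qed.

Lemma jt_part (R : comNzRingType) (H : int -> R) N la :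
  (forall x, x < 0 -> H x = 0) -> H 0 = 1 -> (size la <= N)%N ->
  jt H N (part_idx la) = jt H (size la) (part_idx la).
Proof.
move=> Hneg H0 laN; apply: jt_stable_le => // j /andP[laj _].
by rewrite /part_idx nth_default // sub0r.
Qed.

Lemma sorted_gt_ge (t : seq int) (c : int) :
  sorted >%R t -> all (fun x => c <= x) t ->
  forall j, (j < size t)%N -> c + (size t - j.+1)%:Z <= nth 0 t j.
Proof.
elim: t => //= x t IHt xt /andP[cx ct] [|j] jt /=; last first.
  by rewrite subSS; apply: IHt => //; apply: path_sorted xt.
rewrite subSS subn0 {jt}; case: t IHt xt ct => [_ _ _|y t IHt] /=.
  by rewrite addr0.
move=> /andP[yx yt] ct; have {IHt} := IHt yt ct 0%N isT.
by rewrite /= subSS subn0; move: (size t) yx => k /=; clear; lia.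
Qed.

(** The partition and the sign depend on [q] alone, which is why [R] and [H] are quantified inside
    each alternative: [G_jt] needs one straightening for two families at once. The weight identity
    drives the induction in [E_Delta_span]. *)
Lemma jt_straighten N (q : nat -> int) :
  (forall (R : comNzRingType) (H : int -> R), (forall x, x < 0 -> H x = 0) ->
     jt H N q = 0) \/
  exists (la : seq nat) (s : bool),
    [/\ is_partition la, (size la <= N)%N,
        (sumn la)%:Z = \sum_(j < N) (q j + j%:Z) &
        forall (R : comNzRingType) (H : int -> R),
          (forall x, x < 0 -> H x = 0) -> H 0 = 1 ->
          jt H N q = (-1) ^+ s * jt H (size la) (part_idx la)].
Proof.
pose s := mkseq q N.
have [us|] := boolP (uniq s); last first.
  move=> /(uniqPn 0)[j [k [jk]]]; rewrite size_mkseq => kN.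
  rewrite !nth_mkseq ?(ltn_trans jk) // => qjk; left => R H Hneg.
  by apply: (@jt_rep _ _ _ _ j k); rewrite ?jk.
have [/allP bs|] := boolP (all (fun x => 1 - N%:Z <= x) s); last first.
  move=> /allPn[_ /(nthP 0)[j + <-]]; rewrite size_mkseq => jN.
  rewrite nth_mkseq // => qj; left => R H Hneg.
  by apply: (@jt_neg _ _ _ _ j) => //; move: qj; lia.
right; pose t : seq int := rev (sort <=%R s).
have st : size t = N by rewrite size_rev size_sort size_mkseq.
have gt_t : sorted >%R t by rewrite rev_sorted sort_lt_sorted.
have bt : all (fun x => 1 - N%:Z <= x) t.
  by rewrite all_rev all_sort; apply/allP.
(* The entries are distinct and at least [1 - N], so the one at position [j] is at least [- j] and
   gives a part that is not negative. *)
have ge0 j : (j < N)%N -> 0 <= nth 0 t j + j%:Z.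
  by move=> jN; have := sorted_gt_ge gt_t bt; rewrite st => /(_ _ jN); lia.
pose la := mkseq (fun j => absz (nth 0 t j + j%:Z)) N.
have nla j : (j < N)%N -> (nth 0%N la j)%:Z = nth 0 t j + j%:Z.
  by move=> jN; rewrite nth_mkseq // gez0_abs // ge0.
have sla : sorted geq la.
  apply/(sortedP 0%N) => j; rewrite size_mkseq => jN /=.
  have /(sortedP 0)/(_ j) := gt_t; rewrite st => /(_ jN).
  rewrite -lez_nat !nla // 1?ltnW //=; lia.
have [p pE] : exists p : 'S_N, forall j : 'I_N, q j = part_idx la (p j).
  have /tuple_permP[p pE] :
      perm_eq (mktuple (fun j : 'I_N => q j))
              (mktuple (fun j : 'I_N => nth (0 : int) t j)).
    have -> : tval (mktuple (fun j : 'I_N => q j)) = s.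
      by rewrite /= /s /mkseq -val_enum_ord -map_comp.
    have -> : tval (mktuple (fun j : 'I_N => nth (0 : int) t j)) = t.
      rewrite /= (eq_map (g := nth (0 : int) t \o val)) // map_comp.
      by rewrite val_enum_ord -[X in iota 0 X]st; apply: mkseq_nth.
    by rewrite perm_sym /t perm_rev; apply/permPl/perm_sort.
  exists p => j; have /(congr1 (fun u => nth 0 u j)) := pE.
  rewrite -!tnth_nth !tnth_mktuple => ->.
  by rewrite /part_idx nla ?addrK.
exists [seq x <- la | x != 0%N], p; split.
- rewrite /is_partition mem_filter eqxx andbT; apply: sorted_filter sla.
  by move=> a b c ab bc; apply: leq_trans bc ab.
- by rewrite size_filter (leq_trans (count_size _ _)) ?size_mkseq.
- rewrite sumn_filter_nz sumnE (big_nth 0%N) size_mkseq big_mkord.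
  rewrite (big_morph Posz PoszD (erefl _)) !big_split /=.
  under [X in _ = X + _]eq_bigr do rewrite pE.
  rewrite [X in _ = X + _](reindex_perm p^-1) /=.
  rewrite -big_split /=; apply: eq_bigr => j _.
  by rewrite permKV /part_idx subrK.
- move=> R H Hneg H0; rewrite (jt_perm H pE); congr (_ * _).
  rewrite -(@jt_part _ _ N) //; last first.
    by rewrite size_filter (leq_trans (count_size _ _)) ?size_mkseq.
  by apply: eq_jt => j jN; rewrite /part_idx nth_filter_nz.
Qed.

Lemma sum_ord_trunc (V : nmodType) (F G : nat -> V) n m : (n <= m)%N ->
  (forall i, (i < n)%N -> F i = G i) ->
  (forall i, (n <= i < m)%N -> F i = 0) ->
  \sum_(i < m) F i = \sum_(i < n) G i.
Proof.
move=> nm FG F0; rewrite (big_ord_widen m G nm) [RHS]big_mkcond.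
apply: eq_bigr => i _; case: ltnP => [/FG //|ni].
by rewrite F0 ?ni ?ltn_ord.
Qed.

(** * Brackets as determinants in the [h] *)

Section Brackets.
Variable r : option nat.
Local Notation B := (B r).
Local Notation E := (E r).
Local Notation h := (h r).
Local Notation u := (u r).

Lemma E0 : E 0%N = 1.
Proof. by rewrite /Defs.E /e mul1r. Qed.

Lemma h_neg x : x < 0 -> h x = 0.
Proof. by case: x. Qed.

Lemma h0 : h 0 = 1. Proof. by []. Qed.

Lemma E_gt k l : r = Some k -> (k < l)%N -> E l = 0.
Proof.
move=> rk kl; rewrite /Defs.E /e; case: eqVneq => [l0|_].
  by rewrite l0 in kl.
by rewrite insubF ?mulr0 // /le_r rk [(l <= k)%N]leqNgt kl andbF.
Qed.

(* Otherwise failing unifications of products in B unfold the monoid algebra. *)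
Local Opaque Defs.h Defs.E psinv.

(** This is the coefficient of t^q in E_r(t) times 1/E_r(t). Summing up to any [M] beyond [q] is
    harmless, [h] being zero at negative integers. *)
Lemma sum_E_h (q : int) M : q <= M%:Z ->
  \sum_(l < M.+1) E l * h (q - l%:Z) = (q == 0)%:R.
Proof.
case: q => [m|m] qM; last first.
  by rewrite big1 // => l _; rewrite h_neg ?mulr0 //; lia.
rewrite (eqz_nat m 0).
have <- := @psinvP _ E m E0.
apply: (@sum_ord_trunc _ (fun l => E l * h (Posz m - l%:Z))
          (fun l => E l * psinv E (m - l))) => [|l|l]; first by [].
  by rewrite ltnS => lm; rewrite (subzn lm).
by case/andP => ml _; rewrite h_neg ?mulr0 //; lia.
Qed.

Lemma U_u a j : U a (u j) = \sum_(l < a.+1) E l * h (j + (a - l)%N%:Z).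
Proof.
have uE n : (n`!%:R : rat) *: u j n = h (n%:Z + j).
  rewrite /Defs.u scalerA divff ?scale1r //.
  by rewrite pnatr_eq0 -lt0n fact_gt0.
rewrite /U uE big_ord_recl E0 mul1r subn0 addrC [in RHS]addrC; congr (_ + _).
  rewrite big_add1 /= big_mkord; apply: eq_bigr => l _.
  by rewrite uE addrC.
by rewrite addrC.
Qed.

(** By [U_u] the bracket matrix arises from that of the [h] by convolving its rows with [E], a
    unitriangular operation. *)
Lemma bracket1_jt w : bracket1 r w = jt h (size w.1) (widx w).
Proof.
rewrite /bracket1 /jt.
rewrite -(@det_row_conv _ _ E (fun i (j : 'I__) => h (widx w j + i%:Z)) E0).
by congr (\det _); apply/matrixP => i j; rewrite !mxE U_u.
Qed.

Lemma bracketU c w : bracket r << c *g w >> = c *: bracket1 r w.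
Proof.
rewrite /bracket msuppU; case: eqVneq => [->|_].
  by rewrite big_seq_fset0 scale0r.
by rewrite big_seq_fset1 mcoeffUU.
Qed.

Lemma bracket_sum (I : Type) (s : seq I) (F : I -> {malg rat[wmonom]}) :
  bracket r (\sum_(i <- s) F i) = \sum_(i <- s) bracket r (F i).
Proof.
have ext x (d : {fset wmonom}) : (msupp x `<=` d)%fset ->
    bracket r x = \sum_(w <- d) x@_w *: bracket1 r w.
  move=> xd; rewrite /bracket (big_fset_incl _ xd) // => w _ /mcoeff_outdom ->.
  by rewrite scale0r.
elim: s => [|i s IHs]; first by rewrite !big_nil /bracket msupp0 big_seq_fset0.
rewrite !big_cons -IHs; set x := F i; set y := \sum_(_ <- _) _.
rewrite (ext _ _ (msuppD_le x y)) (ext x _ (fsubsetUl _ (msupp y))).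
rewrite (ext y _ (fsubsetUr (msupp x) _)) -big_split /=.
by apply: eq_bigr => w _; rewrite mcoeffD scalerDl.
Qed.

(** For finite r this kills the determinants of partitions with more than r parts: [E] stops at
    degree [k], so the last of more than [k] rows sees the full convolution. *)
Lemma jt_vanish k N q : r = Some k -> (k < N)%N ->
  (forall j, (j < N)%N -> 0 < q j + N.-1%:Z) -> jt h N q = 0.
Proof.
move=> rk; case: N => // N kN qpos.
rewrite /jt -(@det_row_conv _ _ E (fun i (j : 'I__) => h (q j + i%:Z)) E0).
(* The last row is now a coefficient sequence of E_r(t)/E_r(t) = 1. *)
rewrite (expand_det_row _ ord_max) big1 // => j _; rewrite mxE /=.
have [M MN qM] : exists2 M, (N <= M)%N & q j + N%:Z <= M%:Z.
  by exists (N + `|q j|)%N; lia.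
have := sum_E_h qM; rewrite gt_eqF ?qpos // => s0.
set s := \sum_(l < _) _; suff -> : s = 0 by rewrite mul0r.
rewrite -[RHS]s0 /s; apply/esym.
apply: (@sum_ord_trunc _ (fun l => E l * h (q j + N - l%:Z))
          (fun l => E l * h (q j + (N - l)%N%:Z))) => [|l|l]; first by [].
  by rewrite ltnS => lN; rewrite -(subzn lN) addrA.
by case/andP => lN _; rewrite (E_gt rk) ?mul0r // (leq_trans kN).
Qed.

Lemma Delta_jt la :
  partitions_r r la -> Delta r la = jt h (size la) (part_idx la).
Proof.
move=> /andP[_ ler].
have -> : Delta r la = jt h (odflt (size la) r) (part_idx la) by [].
by apply: jt_part; rewrite ?h0 //; [exact: h_neg|move: ler; case: r].
Qed.

End Brackets.

(** * The images of the [Delta] under G and its dual *)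

Section Vertex.
Variable r : option nat.
Local Notation B := (B r).
Local Notation E := (E r).
Local Notation h := (h r).
Local Opaque Defs.h Defs.E psinv.

(* The coefficient of t^q in a(t/z)/E_r(t), with 'X = z^-1; seqG and seqGV are
   the coefficients of 1 - x and of 1/(1 - x). *)
Definition hconv (a : nat -> rat) (q : int) : {poly B} :=
  \poly_(k < `|q|.+1) (a k *: h (q - k%:Z)).

Definition seqG (k : nat) : rat := [:: 1; -1]`_k.
Definition seqGV (k : nat) : rat := 1.

Lemma coef_hconv a q m : (hconv a q)`_m = a m *: h (q - m%:Z).
Proof.
rewrite coef_poly; case: ltnP => // qm; rewrite h_neg ?scaler0 //.
by move: qm; clear; lia.
Qed.

Lemma hconv_neg a q : q < 0 -> hconv a q = 0.
Proof.
move=> q0; apply/polyP => m; rewrite coef_hconv coef0 h_neg ?scaler0 //; lia.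
Qed.

Lemma hconv_0 a : a 0%N = 1 -> hconv a 0 = 1.
Proof.
move=> a0; apply/polyP => m; rewrite coef_hconv coef1; case: m => [|m].
  by rewrite a0 scale1r subr0 h0.
by rewrite h_neg ?scaler0.
Qed.

Lemma hconv_G q : hconv seqG q = (h q)%:P - 'X * (h (q - 1))%:P.
Proof.
apply/polyP => m; rewrite coef_hconv coefB coefC coefXM coefC /seqG.
case: m => [|[|m]] /=; rewrite ?scale1r ?subr0 ?sub0r //.
  by rewrite scaleN1r.
by rewrite nth_nil scale0r.
Qed.

Local Opaque hconv.

Lemma coef_hconv_GV q m : (hconv seqGV q)`_m = h (q - m%:Z).
Proof. by rewrite coef_hconv /seqGV scale1r. Qed.

(** Multiplying the series for [q - 1] by ['X] gives the series for [q] without its constant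
    term. *)
Lemma hconv_GV q : hconv seqGV q - 'X * hconv seqGV (q - 1) = (h q)%:P.
Proof.
apply/polyP => m; rewrite coefB coef_hconv_GV coefXM coefC coef_hconv_GV.
case: m => [|m] /=; first by rewrite !subr0.
by rewrite -addrA -opprD -intS subrr.
Qed.

(** Through [det_row_conv], the sequence [[:: 1; - 'X]] subtracts from every row ['X] times the row
    above it and keeps row 0. *)
Lemma sum_shift1 (F : nat -> {poly B}) i :
  \sum_(l < i.+1) [:: 1; - 'X]`_l * F l =
  F 0%N - (if i is 0 then 0 else 'X * F 1%N).
Proof.
case: i => [|i]; first by rewrite big_ord1 mul1r subr0.
rewrite 2!big_ord_recl mul1r mulNr big1 ?addr0 // => l _.
by rewrite /= nth_nil mul0r.
Qed.

(* The cofactor of [Gamma_Delta r la n] at row a of the column of u_n. *)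
Definition rminor (la : seq nat) (a : nat) : B :=
  (-1) ^+ a * \det (\matrix_(i < size la, j < size la)
                      h (part_idx la j - 1 + (bump a i)%:Z)).

Lemma Gamma_expand la n :
  Gamma_Delta r la n = \sum_(a < (size la).+1) h (n + a%:Z) * rminor la a.
Proof.
rewrite /Gamma_Delta bracketU scale1r bracket1_jt /=.
rewrite /phi size_mkseq /jt (expand_det_col _ ord0).
apply: eq_bigr => a _; rewrite mxE /= /cofactor addn0; congr (_ * (_ * \det _)).
apply/matrixP => i j; rewrite !mxE; congr (h (_ + _)).
rewrite -[(mkseq _ _, _)]/(phi (-1) la) lift0 widx_wconsS widx_phi /part_idx.
by rewrite addrC addrA addrAC.
Qed.

(** The sum is a Laplace expansion along an adjoined column [1, 'X, 'X^2, ...]. Subtracting ['X]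
    times the row above clears that column below its top entry and, by [hconv_G], turns the
    remaining entries into those on the left. *)
Lemma jt_hconv_G la :
  jt (hconv seqG) (size la) (part_idx la) =
  \sum_(a < (size la).+1) 'X^a * (rminor la a)%:P.
Proof.
set k := size la.
pose A (i : nat) (j : 'I_k.+1) : {poly B} :=
  if unlift ord0 j is Some j' then (h (part_idx la j' - 1 + i%:Z))%:P else 'X^i.
transitivity (\det (\matrix_(i < k.+1, j < k.+1) A i j)); last first.
  rewrite (expand_det_col _ ord0); apply: eq_bigr => a _.
  rewrite mxE /A unlift_none /cofactor addn0 /rminor; congr (_ * _).
  rewrite rmorphM rmorphXn rmorphN1 -det_map_mx; congr (_ * \det _).
  by apply/matrixP => i j; rewrite !mxE liftK.
rewrite -(@det_row_conv _ _ (fun l => [:: 1; - 'X]`_l) A) //.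
rewrite (expand_det_col _ ord0) big_ord_recl big1 => [|i _]; last first.
  rewrite mxE (sum_shift1 (fun l => A (lift ord0 i - l)%N ord0)) /A unlift_none.
  by rewrite lift0 subn0 subn1 /= exprS subrr mul0r.
rewrite addr0 mxE (sum_shift1 (fun l => A (@ord0 k - l)%N ord0)) /= /A.
rewrite unlift_none subr0 mul1r /cofactor expr0 mul1r; congr (\det _).
apply/matrixP => i j.
rewrite !mxE lift0 (sum_shift1 (fun l => A (i.+1 - l)%N (lift ord0 j))) /A.
rewrite liftK subn0 subn1 /= hconv_G; congr ((h _)%:P - 'X * (h _)%:P).
  by rewrite intS addrA subrK.
by rewrite addrAC.
Qed.

(** The sum of h_{n+a} z^n over all n is z^{-a}/E_r(z), so multiplication by E_r(z) leaves z^{-a}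
    times the minors of [Gamma_expand]. *)
Lemma G_Delta G la : is_G G -> partitions_r r la ->
  G (Delta r la) = jt (hconv seqG) (size la) (part_idx la).
Proof.
move=> [_ GE] lar; apply/polyP => n.
transitivity (laurent_of_poly (G (Delta r la)) (- n%:Z)).
  by rewrite /laurent_of_poly oppr_le0 abszN.
rewrite GE // (@lmulE _ _ _ _ (n + size la)) => [|i iN]; last first.
  rewrite Gamma_expand big1 // => a _; rewrite h_neg ?mul0r //.
  by have := ltn_ord a; move: iN; lia.
under eq_bigr => j _ do rewrite Gamma_expand mulr_sumr.
rewrite exchange_big /= jt_hconv_G coef_sum; apply: eq_bigr => a _.
under eq_bigr => j _ do rewrite mulrA addrAC.
rewrite -mulr_suml sum_E_h; last by have := ltn_ord a; lia.
rewrite coefMC coefXn; congr ((_ : bool)%:R * _).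
by apply/eqP/eqP; lia.
Qed.

(* The signed bracket of Phi_{1,la} with its m-th entry omitted. *)
Definition cminor (la : seq nat) N (m : nat) : B :=
  (-1) ^+ m * jt h N (fun j => part_idx la (bump m j) + 1).

Lemma sum_cminor (S : comNzRingType) (f : {rmorphism B -> S})
    (row : int -> S) la N :
  \det (\matrix_(i < N.+1, j < N.+1)
          (if i == ord0 then row (part_idx la j)
           else f (h (part_idx la j + i%:Z)))) =
  \sum_(m < N.+1) row (part_idx la m) * f (cminor la N m).
Proof.
rewrite (expand_det_row _ ord0); apply: eq_bigr => m _.
rewrite mxE eqxx /cofactor add0n /cminor; congr (_ * _).
rewrite rmorphM rmorphXn rmorphN1 -det_map_mx; congr (_ * \det _).
apply/matrixP => i j; rewrite !mxE lift0 /=; congr (f (h _)).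
by rewrite intS addrA.
Qed.

(** Putting row [s] in the place of row 0 produces two equal rows. *)
Lemma sum_cminor_row0 la N s : (0 < s <= N)%N ->
  \sum_(m < N.+1) h (part_idx la m + s%:Z) * cminor la N m = 0.
Proof.
case/andP => s0 sN.
have := sum_cminor idfun (fun q => h (q + s%:Z)) la N => /= <-.
have sN' : (s < N.+1)%N by [].
apply: (@determinant_alternate _ _ _ ord0 (Ordinal sN')).
  by rewrite -val_eqE /= eq_sym -lt0n.
by move=> j; rewrite !mxE /= -val_eqE /= gtn_eqF.
Qed.

(** Subtracting ['X] times the row above turns every row but row 0 into a row of [h], by [hconv_GV];
    expansion along row 0 then yields the minors of the contraction. *)
Lemma jt_hconv_GV la N n : (size la <= N)%N ->
  (jt (hconv seqGV) (size la) (part_idx la))`_n =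
  \sum_(m < N.+1) h (part_idx la m - n%:Z) * cminor la N m.
Proof.
move=> laN.
rewrite -(@jt_part _ _ N.+1) ?leqW //; [|exact: hconv_neg|exact: hconv_0].
have -> : jt (hconv seqGV) N.+1 (part_idx la) =
          \sum_(m < N.+1) hconv seqGV (part_idx la m) * (cminor la N m)%:P.
  rewrite -sum_cminor /jt.
  rewrite -(@det_row_conv _ _ (fun l => [:: 1; - 'X]`_l)
             (fun i (j : 'I_N.+1) => hconv seqGV (part_idx la j + i%:Z))) //.
  congr (\det _); apply/matrixP => i j; rewrite !mxE.
  rewrite (sum_shift1 (fun l => hconv seqGV (part_idx la j + (i - l)%N%:Z))).
  rewrite subn0 -val_eqE /=; case: (i : nat) => [|i'] /=.
    by rewrite subr0 addr0.
  rewrite -hconv_GV subn1 /=; congr (_ - 'X * hconv _ _).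
  by clear; lia.
rewrite coef_sum; apply: eq_bigr => m _.
by rewrite coefMC coef_hconv_GV.
Qed.

(** The contraction has its own cutoff [M], so both sums are reduced to indices below [minn M N.+1]:
    from [M] on no entry matches, by [widx_bound], and past [N] the index is [- m], which cannot
    cancel [n <= N]. *)
Lemma GammaV_expand la N n : (size la <= N)%N -> n <= N%:Z ->
  lshift1 (GammaV_Delta r la) n =
  \sum_(m < N.+1) (part_idx la m + n == 0)%:R * cminor la N m.
Proof.
move=> laN nN; rewrite /lshift1 /GammaV_Delta /contract bracket_sum.
set c := - (n - 1); set M := (_ + _)%N.
have cE m : (c == widx (phi 1 la) m) = (part_idx la m + n == 0).
  rewrite widx_phi /part_idx /c; apply/eqP/eqP; lia.
pose T m : B := (part_idx la m + n == 0)%:R *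
  ((-1) ^+ m * jt h (maxn m (size la)) (fun j => part_idx la (bump m j) + 1)).
have wE m : bracket1 r (womit m (phi 1 la)) =
    jt h (maxn m (size la)) (fun j => part_idx la (bump m j) + 1).
  rewrite bracket1_jt size_map size_iota {1}/phi size_mkseq.
  apply: eq_jt => j _; rewrite widx_womit widx_phi /part_idx.
  by rewrite addrC addrAC addrA addrC addrA.
have TE m : ((-1) ^+ m * (c == widx (phi 1 la) m)%:R : rat) *:
              bracket1 r (womit m (phi 1 la)) = T m.
  rewrite wE cE /T mulrC -scalerA.
  case: (_ == _); last by rewrite scale0r mul0r.
  by rewrite scale1r mul1r -signr_odd -[in RHS]signr_odd scaler_sign mulr_sign.
transitivity (\sum_(m < M) T m).
  by apply: eq_bigr => m _; rewrite bracketU TE.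
transitivity (\sum_(m < minn M N.+1) T m).
  apply: (@sum_ord_trunc _ T T) => [|m _|m]; [exact: geq_minl|by []|].
  rewrite geq_min => /andP[/orP[Mm|Nm]]; first by rewrite ltnNge Mm.
  move=> _; rewrite /T /part_idx nth_default; last first.
    exact: leq_trans laN (ltnW Nm).
  have -> : (0%N%:Z - m%:Z + n == 0) = false by apply/negbTE/eqP; lia.
  by rewrite mul0r.
apply/esym.
apply: (@sum_ord_trunc _
    (fun m => (part_idx la m + n == 0)%:R * cminor la N m) T)
  => [|m|m]; first exact: geq_minr.
  rewrite leq_min ltnS => /andP[_ mN]; rewrite /T /cminor; congr (_ * (_ * _)).
  (* Beyond [m] and the length of [la], omitting an entry makes the index [part_idx la j.+1 + 1],
     which is [- j], as stability requires. *)
  apply: jt_stable_le; [exact: h_neg|exact: h0| |by rewrite geq_max mN].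
  move=> j /andP[]; rewrite geq_max => /andP[mj laj] jN.
  rewrite /part_idx /bump mj nth_default ?(leq_trans laj) //; lia.
rewrite geq_min => /andP[/orP[Mm _|Nm]]; last by rewrite ltnNge Nm.
rewrite -cE; case: eqVneq => [cm|]; last by rewrite mul0r.
by have := widx_bound Mm; rewrite -cm.
Qed.

(** In exponents at most 0, the shifted contraction series consists of the terms z^{-p}
    [cminor la N m] with p = [part_idx la m]. Dividing by E_r(z) puts h_{p-n} at z^{-n}, as in
    [jt_hconv_GV]. *)
Lemma GV_Delta G la : is_GV G -> partitions_r r la ->
  G (Delta r la) = jt (hconv seqGV) (size la) (part_idx la).
Proof.
move=> [_ GE] lar; apply/polyP => n.
transitivity (laurent_of_poly (G (Delta r la)) (- n%:Z)).
  by rewrite /laurent_of_poly oppr_le0 abszN.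
set N := size la.
pose K := (\sum_(m < N.+1) `|part_idx la m|)%N.
have leK (m : 'I_N.+1) : part_idx la m <= K%:Z.
  apply: (le_trans (ler_norm _)); rewrite -abszE lez_nat.
  by rewrite /K (bigD1 m) //= leq_addr.
have expand i : i <= 0 -> lshift1 (GammaV_Delta r la) i =
    \sum_(m < N.+1) (part_idx la m + i == 0)%:R * cminor la N m.
  by move=> i0; apply: GammaV_expand => //; lia.
rewrite GE // (@lmulE _ _ _ _ K) => [|i iN]; last first.
  rewrite expand; last by lia.
  rewrite big1 // => m _.
  have -> : (part_idx la m + i == 0) = false.
    by apply/negbTE/eqP; have := leK m; lia.
  by rewrite mul0r.
have expandn (j : nat) := expand (- n%:Z - j%:Z) (ltac:(lia)).
under eq_bigr => j _ do rewrite expandn mulr_sumr.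
rewrite exchange_big /= (@jt_hconv_GV _ N) //; apply: eq_bigr => m _.
under eq_bigr => j _ do rewrite mulrA.
rewrite -mulr_suml; congr (_ * _).
have [q0|q0] := ltP (part_idx la m - n%:Z) 0.
  rewrite h_neg // big1 // => j _.
  have -> : (part_idx la m + (- n%:Z - j%:Z) == 0) = false.
    by apply/negbTE/eqP; lia.
  by rewrite mulr0.
have [q qE] : exists q : nat, part_idx la m - n%:Z = q.
  by exists `|part_idx la m - n%:Z|%N; lia.
have qK : (q < K.+1)%N by have := leK m; lia.
rewrite (bigD1 (Ordinal qK)) //= big1 => [|j jq]; last first.
  have -> : (part_idx la m + (- n%:Z - j%:Z) == 0) = false.
    by apply/negbTE/eqP; move: jq; rewrite -val_eqE /=; lia.
  by rewrite mulr0.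
have -> : (part_idx la m + (- n%:Z - q%:Z) == 0) by apply/eqP; lia.
by rewrite mulr1 addr0 qE.
Qed.

(** Let S_l be the sum of [h (part_idx la m + n - l) * cminor la N m] over m. It vanishes for l < n
    by a repeated row, and S_{n+l} is the coefficient of ['X^l] in the deformed determinant, so S_n
    is the undeformed one. By [sum_E_h] the convolution of S with [E] collapses to the delta terms;
    the claim solves this for the term of index n. *)
Lemma e_Delta la N n : (size la <= N)%N -> (n <= N)%N ->
  exists K, E n * jt h (size la) (part_idx la) =
  \sum_(m < N.+1) (part_idx la m + n%:Z == 0)%:R * cminor la N m
  - \sum_(l < K)
      E (n + l.+1)%N * (jt (hconv seqGV) (size la) (part_idx la))`_l.+1.
Proof.
move=> laN nN.
pose K := (\sum_(m < N.+1) `|part_idx la m|)%N.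
have leK (m : 'I_N.+1) : part_idx la m <= K%:Z.
  apply: (le_trans (ler_norm _)); rewrite -abszE lez_nat.
  by rewrite /K (bigD1 m) //= leq_addr.
exists K.
have D0 : (jt (hconv seqGV) (size la) (part_idx la))`_0 =
          jt h (size la) (part_idx la).
  rewrite -[LHS]/(coefp 0 _) /jt -det_map_mx; congr (\det _).
  by apply/matrixP => i j; rewrite !mxE /= coef_hconv_GV subr0.
pose S (l : nat) :=
  \sum_(m < N.+1) h (part_idx la m + n%:Z - l%:Z) * cminor la N m.
have S0 l : (l < n)%N -> S l = 0.
  move=> ln; rewrite -[RHS](@sum_cminor_row0 la N (n - l)); last by lia.
  by apply: eq_bigr => m _; congr (h _ * _); lia.
have Sn l : S (n + l)%N = (jt (hconv seqGV) (size la) (part_idx la))`_l.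
  rewrite (jt_hconv_GV _ laN); apply: eq_bigr => m _.
  by congr (h _ * _); clear; lia.
have sumES : \sum_(l < n + K.+1) E l * S l =
       \sum_(m < N.+1) (part_idx la m + n%:Z == 0)%:R * cminor la N m.
  under eq_bigr => l _ do rewrite mulr_sumr.
  rewrite exchange_big /=; apply: eq_bigr => m _.
  under eq_bigr => l _ do rewrite mulrA.
  by rewrite -mulr_suml addnS sum_E_h //; have := leK m; lia.
rewrite -sumES -D0; have <- := Sn 0%N; clear sumES.
move: (S) S0 Sn => T T0 Tn.
rewrite big_split_ord big1 /= => [|l _]; last by rewrite T0 ?mulr0.
rewrite add0r big_ord_recl /= addn0; apply/esym/eqP; rewrite subr_eq; apply/eqP.
apply: (congr1 (+%R _)); apply: eq_bigr => l _.
by rewrite -Tn /bump leq0n add1n.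
Qed.

End Vertex.

(** * Column expansions and the extension over Q[z^-1] *)

Lemma det_col_sum (S : comNzRingType) N K (c : 'I_K -> S)
    (F : 'I_N -> 'I_N -> 'I_K -> S) :
  \det (\matrix_(i < N, j < N) \sum_k c k * F i j k) =
  \sum_(f : {ffun 'I_N -> 'I_K})
     (\prod_j c (f j)) * \det (\matrix_(i < N, j < N) F i j (f j)).
Proof.
rewrite -det_tr [LHS]/determinant.
under eq_bigr => s _.
  under eq_bigr => j _ do rewrite !mxE.
  (* Here [f] records which summand is chosen in each column. *)
  rewrite bigA_distr_bigA mulr_sumr.
  over.
rewrite exchange_big; apply: eq_bigr => f _.
rewrite -det_tr /determinant mulr_sumr; apply: eq_bigr => s _.
rewrite big_split /= mulrCA; congr (_ * (_ * _)).
by apply: eq_bigr => j _; rewrite !mxE.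
Qed.

Definition shift_idx N K (q : nat -> int) (f : {ffun 'I_N -> 'I_K}) (j : nat) :=
  q j - (oapp (fun i => val (f i)) 0%N (insub j))%:Z.

Lemma shift_idxE N K q (f : {ffun 'I_N -> 'I_K}) (j : 'I_N) :
  shift_idx q f j = q j - (f j)%:Z.
Proof. by rewrite /shift_idx valK. Qed.

Section Composition.
Local Opaque Defs.h Defs.E psinv hconv.
Variable r : option nat.
Local Notation B := (B r).
Local Notation E := (E r).
Local Notation h := (h r).
Local Notation hconv := (hconv r).
Implicit Types (G : B -> {poly B}).

Lemma Qlinear0 G : Qlinear G -> G 0 = 0.
Proof.
move=> GL; have := GL 1 0 0; rewrite scaler0 addr0 !scale1r => G00.
by apply: (addIr (G 0)); rewrite add0r -G00.
Qed.

Lemma QlinearD G : Qlinear G -> {morph G : x y / x + y}.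
Proof. by move=> GL x y; have := GL 1 x y; rewrite !scale1r. Qed.

Lemma QlinearZ G c x : Qlinear G -> G (c *: x) = (c%:A : B) *: G x.
Proof. by move=> GL; have := GL c x 0; rewrite addr0 Qlinear0 // addr0. Qed.

Lemma zext_widen G (p : {poly B}) m : Qlinear G -> (size p <= m)%N ->
  zext G p = \sum_(i < m) 'X^i * G p`_i.
Proof.
move=> GL pm; apply/esym.
pose F i := 'X^i * G p`_i.
apply: (@sum_ord_trunc _ F F) => [|i _|i]; [exact: pm|by []|].
by case/andP => pi _; rewrite /F nth_default // Qlinear0 // mulr0.
Qed.

Lemma zextD G : Qlinear G -> {morph zext G : p q / p + q}.
Proof.
move=> GL p q; pose m := maxn (size p) (size q).
rewrite (@zext_widen _ p m) ?leq_maxl // (@zext_widen _ q m) ?leq_maxr //.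
rewrite (@zext_widen _ (p + q) m) ?size_polyD // -big_split.
by apply: eq_bigr => i _; rewrite coefD QlinearD // mulrDr.
Qed.

Lemma zext0 G : zext G 0 = 0.
Proof. by rewrite /zext size_poly0 big_ord0. Qed.

Lemma zext_sum G (I : Type) (s : seq I) (F : I -> {poly B}) : Qlinear G ->
  zext G (\sum_(i <- s) F i) = \sum_(i <- s) zext G (F i).
Proof. by move=> GL; apply: (big_morph _ (zextD GL) (zext0 G)). Qed.

Lemma zextC G x : Qlinear G -> zext G x%:P = G x.
Proof.
move=> GL; rewrite (@zext_widen _ _ 1) ?size_polyC_leq1 //.
by rewrite big_ord1 coefC mul1r.
Qed.

Lemma zextZ G c p :
  Qlinear G -> zext G ((c%:A : B) *: p) = (c%:A : B) *: zext G p.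
Proof.
move=> GL; rewrite (@zext_widen _ _ (size p)) ?size_scale_leq // /zext.
rewrite scaler_sumr; apply: eq_bigr => i _.
by rewrite coefZ mulr_algl QlinearZ // scalerAr.
Qed.

Lemma zextX G p : Qlinear G -> zext G ('X * p) = 'X * zext G p.
Proof.
move=> GL; rewrite (@zext_widen _ _ (size p).+1) //; last first.
  by rewrite mulrC (leq_trans (size_polyMleq _ _)) // size_polyX addn2.
rewrite big_ord_recl coefXM Qlinear0 // mulr0 add0r /zext mulr_sumr.
apply: eq_bigr => i _; rewrite lift0 coefXM /= exprS -!mulrA; reflexivity.
Qed.

Lemma zextXn G n p : Qlinear G -> zext G ('X^n * p) = 'X^n * zext G p.
Proof.
move=> GL; elim: n => [|n IHn]; first by rewrite !mul1r.
by rewrite exprS -!mulrA zextX // IHn.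
Qed.

(** The scalar c z^{-k} of Q[z^-1], over which [zext] is linear. *)
Definition mono (c : rat) (k : nat) : {poly B} := (c%:A : B) *: 'X^k.

Lemma zext_mono G c k p :
  Qlinear G -> zext G (mono c k * p) = mono c k * zext G p.
Proof. by move=> GL; rewrite /mono -!scalerAl zextZ // zextXn. Qed.

Lemma prod_mono (I : finType) (a : I -> rat) (k : I -> nat) :
  \prod_i mono (a i) (k i) = mono (\prod_i a i) (\sum_i k i).
Proof.
rewrite /mono; under eq_bigr => i _ do rewrite -mul_polyC.
rewrite big_split /= -rmorph_prod -mul_polyC -expr_sum /=; congr (_%:P * _).
by rewrite -[RHS]/(in_alg B _) rmorph_prod.
Qed.

Lemma coef_mono_mul c k p m :
  (mono c k * p)`_m = if (m < k)%N then 0 else c *: p`_(m - k)%N.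
Proof.
rewrite /mono -scalerAl coefZ coefXnM; case: ifP => _; first by rewrite mulr0.
by rewrite mulr_algl.
Qed.

Lemma hconv_mono (a : nat -> rat) q K : (`|q| < K)%N ->
  hconv a q = \sum_(k < K) mono (a k) k * (h (q - k%:Z))%:P.
Proof.
move=> qK; apply/polyP => m; rewrite coef_hconv coef_sum.
under eq_bigr => k _ do rewrite coef_mono_mul coefC.
case: (ltnP m K) => [mK|Km]; last first.
  rewrite h_neg ?scaler0; last by lia.
  rewrite big1 // => k _; case: ifP => // _.
  by rewrite subn_eq0 leqNgt (leq_trans (ltn_ord k) Km) scaler0.
rewrite (bigD1 (Ordinal mK)) //= ltnn subnn eqxx big1 ?addr0 // => k km.
case: ltnP => // km'; rewrite subn_eq0 leqNgt ltn_neqAle km' andbT.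
by move: km; rewrite -val_eqE /= => ->; rewrite scaler0.
Qed.

(** In degree [m] the factor of [h (q - m)] is the coefficient of index [m] in the product of the
    series of [a] and [b], which is 1. *)
Lemma hconv_conv (a b : nat -> rat) q K : (`|q| < K)%N ->
  (forall m, \sum_(k < m.+1) a k * b (m - k)%N = (m == 0%N)%:R) ->
  \sum_(k < K) mono (a k) k * hconv b (q - k%:Z) = (h q)%:P.
Proof.
move=> qK ab; apply/polyP => m; rewrite coef_sum coefC.
under eq_bigr => k _ do rewrite coef_mono_mul coef_hconv.
case: (ltnP m K) => [mK|Km]; last first.
  rewrite big1 => [|k _]; first by case: m Km => //; lia.
  case: ifP => // _; rewrite h_neg ?scaler0 //.
  by have := ltn_ord k; lia.
transitivity (\sum_(k < m.+1) (a k * b (m - k)%N) *: h (q - m%:Z)).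
  apply: (@sum_ord_trunc _
    (fun k => if (m < k)%N then 0
              else a k *: (b (m - k)%N *: h (q - k%:Z - (m - k)%N%:Z)))
    (fun k => (a k * b (m - k)%N) *: h (q - m%:Z))) => [|k|k]; first exact: mK.
    rewrite ltnS => km; rewrite ltnNge km /= scalerA; congr (_ *: h _); lia.
  by case/andP => ->.
rewrite -scaler_suml ab; case: eqVneq => [->|_]; last by rewrite scale0r.
by rewrite scale1r subr0.
Qed.

Lemma jt_bound N (q : nat -> int) :
  exists K, forall i j : 'I_N, (`|(q j + i%:Z)%R| < K)%N.
Proof.
exists (\sum_(j < N) \sum_(i < N) `|(q j + i%:Z)%R|).+1%N => i j.
by rewrite ltnS (bigD1 j) //= (bigD1 i) //= -addnA leq_addr.
Qed.

Lemma jt_hconv_expand (a : nat -> rat) N (q : nat -> int) K :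
  (forall i j : 'I_N, (`|(q j + i%:Z)%R| < K)%N) ->
  jt (hconv a) N q = \sum_(f : {ffun 'I_N -> 'I_K})
    mono (\prod_j a (f j)) (\sum_j f j) * (jt h N (shift_idx q f))%:P.
Proof.
move=> qK; rewrite /jt.
transitivity (\det (\matrix_(i < N, j < N)
    \sum_(k < K) mono (a k) k * (h (q j + i%:Z - k%:Z))%:P)).
  by congr (\det _); apply/matrixP => i j; rewrite !mxE (hconv_mono _ (qK i j)).
rewrite det_col_sum; apply: eq_bigr => f _.
rewrite prod_mono -det_map_mx; congr (_ * \det _); apply/matrixP => i j.
by rewrite !mxE shift_idxE addrAC.
Qed.

Section Extension.
Variables (G : B -> {poly B}) (a : nat -> rat).
Hypotheses (GL : Qlinear G) (a0 : a 0%N = 1).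
Hypothesis GE : forall la, partitions_r r la ->
  G (Delta r la) = jt (hconv a) (size la) (part_idx la).

(** By [jt_straighten] both determinants reduce to the same partition with the same sign, or both
    vanish. The bound on [N] keeps that partition where [GE] applies. *)
Lemma G_jt N q : le_r r N -> G (jt h N q) = jt (hconv a) N q.
Proof.
move=> rN; case: (jt_straighten N q) => [q0|[la [s [pla laN _ jtE]]]].
  rewrite q0; last exact: h_neg.
  rewrite q0 ?Qlinear0 //; exact: hconv_neg.
have rla : partitions_r r la.
  rewrite /partitions_r pla; move: rN; rewrite /le_r.
  by case: r => // k; apply: leq_trans.
rewrite (jtE _ h (@h_neg r) (h0 r)).
rewrite (jtE _ (hconv a) (@hconv_neg r a) (hconv_0 _ a0)) -GE // -Delta_jt //.
have -> : (-1) ^+ s * Delta r la = ((-1) ^+ s : rat) *: Delta r la.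
  by rewrite -mulr_algl -[_%:A]/(in_alg B _) rmorphXn rmorphN1.
by rewrite QlinearZ // -mul_polyC -[_%:A]/(in_alg B _) !rmorphXn !rmorphN1.
Qed.

End Extension.

(** Column expansion splits the argument into scalars times determinants of [h] at lowered indices,
    on which [G] is known even if the indices form no partition. The images recombine column by
    column, and there the series of [a] and [b] cancel. *)
Lemma zext_jt (G : B -> {poly B}) (a b : nat -> rat) N q : Qlinear G ->
  (forall q', G (jt h N q') = jt (hconv b) N q') ->
  (forall m, \sum_(k < m.+1) a k * b (m - k)%N = (m == 0%N)%:R) ->
  zext G (jt (hconv a) N q) = (jt h N q)%:P.
Proof.
move=> GL GE ab; have [K qK] := jt_bound N q.
rewrite (jt_hconv_expand _ qK) zext_sum //.
under eq_bigr => f _ do rewrite zext_mono // zextC // GE -prod_mono.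
transitivity (\det (\matrix_(i < N, j < N)
    \sum_(k < K) mono (a k) k * hconv b (q j + i%:Z - k%:Z))).
  rewrite det_col_sum; apply: eq_bigr => f _.
  apply: (congr1 ( *%R _)); apply: (congr1 determinant).
  by apply/matrixP => i j; rewrite [LHS]mxE [RHS]mxE shift_idxE addrAC.
rewrite -det_map_mx; congr (\det _); apply/matrixP => i j.
by rewrite !mxE (hconv_conv (qK i j) ab).
Qed.

End Composition.

Lemma malgU_scale (R : nzRingType) (K : choiceType) (c : R) (k : K) :
  << c *g k >> = c *: << k >> :> {malg R[K]}.
Proof. by apply/malgP => k'; rewrite mcoeffZ !mcoeffU mulrnAr mulr1. Qed.

(** * The [Delta] span B_r *)

Section Span.
Local Opaque Defs.h Defs.E psinv hconv.
Variable r : option nat.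
Local Notation B := (B r).
Local Notation E := (E r).
Local Notation h := (h r).
Local Notation hconv := (hconv r).

Inductive Dspan : B -> Prop :=
| Dspan0 : Dspan 0
| Dspan_lin c x y : Dspan x -> Dspan y -> Dspan (c *: x + y)
| Dspan_Delta la : partitions_r r la -> Dspan (Delta r la).

Lemma DspanD x y : Dspan x -> Dspan y -> Dspan (x + y).
Proof. by move=> Dx Dy; rewrite -[x]scale1r; apply: Dspan_lin. Qed.

Lemma DspanZ c x : Dspan x -> Dspan (c *: x).
Proof. by move=> Dx; rewrite -[_ *: _]addr0; exact: Dspan_lin Dx Dspan0. Qed.

Lemma Dspan_sign n x : Dspan x -> Dspan ((-1) ^+ n * x).
Proof.
move=> Dx; rewrite -signr_odd mulr_sign; case: odd => //.
by rewrite -scaleN1r; apply: DspanZ.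
Qed.

Lemma Dspan_sum (I : Type) (s : seq I) (F : I -> B) :
  (forall i, Dspan (F i)) -> Dspan (\sum_(i <- s) F i).
Proof.
by move=> DF; apply: big_ind => // [|x y]; [exact: Dspan0|exact: DspanD].
Qed.

Lemma le_rN n : ~~ le_r r n -> exists2 k, r = Some k & (k < n)%N.
Proof. by case: r => //= k; rewrite -ltnNge; exists k. Qed.

(** Straightening may return a partition with more than r parts; [jt_vanish] disposes of that
    case. *)
Lemma jt_eq0_or_Delta N q : jt h N q = 0 \/
  exists (la : seq nat) (s : bool),
    [/\ partitions_r r la, (sumn la)%:Z = \sum_(j < N) (q j + j%:Z) &
        jt h N q = (-1) ^+ s * Delta r la].
Proof.
case: (jt_straighten N q) => [q0|[la [s [pla laN wla jtE]]]].
  by left; apply: q0; exact: h_neg.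
have := jtE _ h (@h_neg r) (h0 r).
have [rla|] := boolP (le_r r (size la)).
  have lar : partitions_r r la by rewrite /partitions_r pla.
  by rewrite -Delta_jt // => ->; right; exists la, s.
move=> /le_rN[k rk kla] ->; left.
rewrite (jt_vanish rk kla) ?mulr0 // => j jla.
have : nth 0%N la j != 0%N.
  case/andP: pla => _; apply: contraNneq => n0.
  by have := mem_nth 0%N jla; rewrite n0.
by rewrite /part_idx; lia.
Qed.

Lemma jt_span N q : Dspan (jt h N q).
Proof.
case: (jt_eq0_or_Delta N q) => [->|[la [s [lar _ ->]]]]; first exact: Dspan0.
exact/Dspan_sign/Dspan_Delta.
Qed.

Lemma sum_part la : \sum_(j < size la) (part_idx la j + j%:Z) = (sumn la)%:Z.
Proof.
rewrite sumnE (big_nth 0%N) big_mkord (big_morph Posz PoszD (erefl _)).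
by apply: eq_bigr => j _; rewrite /part_idx subrK.
Qed.

(** Induction on the weight with [n] free: [e_Delta] raises the index of [E] but lowers the weight
    of the determinants beside it. *)
Lemma E_Delta_span n la : partitions_r r la -> Dspan (E n * Delta r la).
Proof.
have [w] := ubnP (sumn la); elim: w la n => // w IHw la n law lar.
pose N := maxn n (size la).
have [K eE] := @e_Delta r la N n (leq_maxr _ _) (leq_maxl _ _).
rewrite (Delta_jt lar) eE; apply: DspanD.
  apply: Dspan_sum => m; case: (_ == _); last by rewrite mul0r; exact: Dspan0.
  by rewrite mul1r; apply: Dspan_sign; exact: jt_span.
rewrite -scaleN1r; apply: DspanZ; apply: Dspan_sum => l.
have [M qM] := jt_bound (size la) (part_idx la).
rewrite (jt_hconv_expand r seqGV qM) coef_sum mulr_sumr; apply: Dspan_sum => f.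
rewrite coef_mono_mul; case: ltnP => [_|fl].
  by rewrite mulr0; exact: Dspan0.
(* Only an [f] whose shifts add up to exactly [l.+1] contributes, so the weight drops strictly. *)
rewrite coefC subn_eq0; case: ifP => lf; last first.
  by rewrite scaler0 mulr0; exact: Dspan0.
rewrite -scalerAr; apply: DspanZ.
case: (jt_eq0_or_Delta (size la) (shift_idx (part_idx la) f))
  => [->|[mu [s [mur wmu ->]]]].
  by rewrite mulr0; exact: Dspan0.
rewrite mulrCA; apply: Dspan_sign; apply: IHw => //.
have : (sumn mu)%:Z + (\sum_j f j)%N%:Z = (sumn la)%:Z.
  rewrite wmu -sum_part (big_morph Posz PoszD (erefl _)) -big_split /=.
  by apply: eq_bigr => j _; rewrite shift_idxE; lia.
by move: (\sum_j f j)%N law lf => F; clear; lia.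
Qed.

Lemma E_span n x : Dspan x -> Dspan (E n * x).
Proof.
elim=> [|c y z _ IHy _ IHz|la]; last exact: E_Delta_span.
  by rewrite mulr0; exact: Dspan0.
rewrite mulrDr -scalerAr; exact: Dspan_lin IHy IHz.
Qed.

Lemma ucm_E (i : eindex r) : << ucm i >> = (-1) ^+ val i * E (val i) :> B.
Proof.
have -> : E (val i) = (-1) ^+ val i * e r (val i) by [].
rewrite mulrA -expr2 sqrr_sign mul1r /e.
have /andP[/lt0n_neq0/negbTE-> _] := valP i.
by rewrite valK.
Qed.

Lemma Dspan1 : Dspan 1.
Proof. by have := jt_span 0 (part_idx [::]); rewrite /jt det_mx00. Qed.

Lemma Dspan_all x : Dspan x.
Proof.
have Dm (m : {cmonom eindex r}) : Dspan << m >>.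
  have [w] := ubnP (mdeg m); elim: w m => [|w IHw] m mw.
    by exfalso; rewrite ltn0 in mw.
  have [->|] := eqVneq m mone; first exact: Dspan1.
  rewrite -mdeg_eq0 mdegE => m0.
  have [i im] : exists i, i \in finsupp m.
    apply/fset0Pn; apply: contraNneq m0 => ->; by rewrite big_seq_fset0.
  have mE : m = mmul (ucm i) (divcm m (ucm i)).
    apply/eqP/cmP => j; rewrite cmM divcmE ucmE subnKC //.
    by case: eqVneq => // <-; rewrite lt0n cmE_neq0.
  have -> : << m >> = << ucm i >> * << divcm m (ucm i) >> :> B.
    by rewrite malgM_def fgmulUU mulr1 -mE.
  rewrite ucm_E -mulrA; apply: Dspan_sign; apply: E_span; apply: IHw.
  by move: mw; rewrite {1}mE mdegM mdegU.
rewrite (monalgE x); apply: Dspan_sum => m.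
rewrite malgU_scale; exact: DspanZ.
Qed.

(** * The two compositions on B_r[z^-1] *)

Lemma zext_comp (G H : B -> {poly B}) (a b : nat -> rat) :
  Qlinear G -> Qlinear H ->
  a 0%N = 1 -> b 0%N = 1 ->
  (forall la, partitions_r r la ->
     G (Delta r la) = jt (hconv a) (size la) (part_idx la)) ->
  (forall la, partitions_r r la ->
     H (Delta r la) = jt (hconv b) (size la) (part_idx la)) ->
  (forall m, \sum_(k < m.+1) b k * a (m - k)%N = (m == 0%N)%:R) ->
  zext G \o zext H =1 id.
Proof.
move=> GL HL a0 b0 GE HE ba p /=.
rewrite [zext H p]/zext zext_sum // -[RHS]coefK poly_def; apply: eq_bigr => i _.
rewrite zextXn // mulrC -mul_polyC; congr (_ * _).
(* What remains concerns one coefficient in [B], and spanning reduces it by linearity to a single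
   [Delta]. *)
elim: (Dspan_all p`_i) => [|c x y _ IHx _ IHy|la lar].
- by rewrite Qlinear0 // zext0.
- by rewrite HL zextD // zextZ // IHx IHy -mul_polyC rmorphD -polyCM mulr_algl.
- rewrite HE // (Delta_jt lar); apply: zext_jt => // q.
  by apply: G_jt => //; case/andP: lar.
Qed.

Lemma seqG_seqGV m : \sum_(k < m.+1) seqG k * seqGV (m - k)%N = (m == 0%N)%:R.
Proof.
under eq_bigr => k _ do rewrite mulr1.
case: m => [|m]; first by rewrite big_ord1.
rewrite 2!big_ord_recl big1 /= ?addr0 => [|k _]; first by rewrite subrr.
by rewrite /seqG /= nth_nil.
Qed.

Lemma seqGV_seqG m : \sum_(k < m.+1) seqGV k * seqG (m - k)%N = (m == 0%N)%:R.
Proof.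
rewrite -seqG_seqGV (reindex_inj rev_ord_inj) /=; apply: eq_bigr => k _.
by rewrite subSS mulrC subKn // -ltnS.
Qed.

End Span.

Theorem corollary7p4 (r : option nat) (hr : r <> Some 0%N)
    (G GV : B r -> {poly B r}) (hG : is_G G) (hGV : is_GV GV) :
  (zext G \o zext GV =1 id) /\ (zext GV \o zext G =1 id).
Proof.
have GE la := @G_Delta r G la hG; have GVE la := @GV_Delta r GV la hGV.
case: hG hGV => GL _ [GVL _]; split.
  exact: zext_comp GL GVL _ _ GE GVE seqGV_seqG.
exact: zext_comp GVL GL _ _ GVE GE seqG_seqGV.
Qed.
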